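(* Let $\Omega\subset\mathbb{R}^N$ be a bounded domain and let $1\le j\le N$. (a) If $\partial\Omega$ is of class $C^2$ and $\Omega$ satisfies condition (H), then $\Omega$ satisfies condition (F), i.e. both $(F_j)$ and $(F_{N-j+1})$. (b) If $\Omega$ satisfies condition (F), then $\Omega$ satisfies condition (G), i.e. both $(G_j)$ and $(G_{N-j+1})$. In short, (H) $\Rightarrow$ (F) $\Rightarrow$ (G).
   Context: Condition (H), for $\Omega$ with $C^2$ boundary: letting $\kappa_1(x)\le\dots\le\kappa_{N-1}(x)$ be the main (principal) curvatures of $\partial\Omega$ at $x$, with the sign convention that they are positive for a ball (locally, with the boundary point at the origin and $x_N$ the inner normal direction, $\Omega$ is $\{x_N>\frac12\sum_{i=1}^{N-1}\kappa_ix_i^2+o(\sum_{i=1}^{N-1} x_i^2)\}$), one has $\kappa_j(x)>0$ and $\kappa_{N-j+1}(x)>0$ for all $x\in\partial\Omega$. A requirement whose index equals $N$ (which occurs when $j=1$ or $j=N$) is void. Condition $(F_k)$, for $1\le k\le N$: for every $y\in\partial\Omega$ there exists $r>0$ such that for every $\delta>0$ there exist a linear subspace $T\subset\mathbb{R}^N$ of dimension $k$, a vector $v\in\mathbb{R}^N$ with $|v|=1$, $\lambda>0$ and $\theta>0$ such that $$\{x\in\Omega\cap B_r(y)\cap T_\lambda:\ \langle v,x-y\rangle<\theta\}\subset B_\delta(y),\qquad T_\lambda=\{x\in\mathbb{R}^N:\ d(x,y+T)<\lambda\}.$$ Condition $(G_k)$, for $1\le k\le N$: for every $y\in\partial\Omega$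 and every $r>0$ there exists $\delta>0$ such that for every $x\in B_\delta(y)\cap\Omega$ and every linear subspace $S\subset\mathbb{R}^N$ of dimension $k$ there exists $v\in S$ with $|v|=1$ such that $\{x+tv:t\in\mathbb{R}\}\cap B_r(y)\cap\partial\Omega\ne\emptyset$. *)

(* Defs.v *)
From HB Require Import structures.
From mathcomp Require Import all_boot all_order all_algebra.
From mathcomp Require Import all_classical all_reals all_analysis.
Set Implicit Arguments.
Unset Strict Implicit.
Unset Printing Implicit Defensive.
Import Order.TTheory GRing.Theory Num.Theory numFieldNormedType.Exports.
Local Open Scope classical_set_scope.
Local Open Scope ring_scope.

(* The library norm on 'rV[R]_m is the sup norm: it has the right topology
   (and the right bounded sets), but |.|, B_r(y) and d below are Euclidean. *)
Definition edot (R : realType) (m : nat) (u v : 'rV[R]_m) : R :=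
  (u *m v^T) 0 0.

Definition enorm (R : realType) (m : nat) (u : 'rV[R]_m) : R :=
  Num.sqrt (edot u u).

Definition eball (R : realType) (m : nat) (y : 'rV[R]_m) (r : R) :
  set 'rV[R]_m := [set x | enorm (x - y) < r].

Definition edist (R : realType) (m : nat) (x : 'rV[R]_m) (A : set 'rV[R]_m) :
  R := inf [set enorm (x - a) | a in A].

Definition boundary (T : topologicalType) (A : set T) : set T :=
  closure A `\` interior A.

Definition is_domain (T : topologicalType) (A : set T) : Prop :=
  [/\ A !=set0, open A & connected A].

Definition C1 (R : realType) (n : nat) (f : 'rV[R]_n -> R) : Prop :=
  (forall x, differentiable f x) /\
  (forall v : 'rV[R]_n, continuous (fun x => 'D_v f x)).

Definition C2 (R : realType) (n : nat) (f : 'rV[R]_n -> R) : Prop :=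
  C1 f /\ (forall v : 'rV[R]_n, C1 (fun x => 'D_v f x)).

Definition gradient (R : realType) (n : nat) (f : 'rV[R]_n -> R)
    (x : 'rV[R]_n) : 'rV[R]_n :=
  \row_(i < n) 'D_('e_i) f x.

Definition hessian (R : realType) (n : nat) (f : 'rV[R]_n -> R)
    (x : 'rV[R]_n) : 'M[R]_n :=
  \matrix_(i < n, k < n) 'D_('e_i) (fun z => 'D_('e_k) f z) x.

(* Near y, Omega is the strict epigraph of the C^2 function phi in Cartesian
   coordinates centred at y: the rows of E are the n first axes and u is the
   last one, so that x has coordinates ((x - y) E^T, <u, x - y>).  The axis u
   points into Omega but need not be normal to the boundary at y. *)
Definition local_graph (R : realType) (n : nat) (Omega : set 'rV[R]_n.+1)
    (y : 'rV[R]_n.+1) (E : 'M[R]_(n, n.+1)) (u : 'rV[R]_n.+1)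
    (phi : 'rV[R]_n -> R) : Prop :=
  [/\ E *m E^T = 1%:M, E *m u^T = 0, enorm u = 1, C2 phi &
    exists2 rho : R, 0 < rho &
      forall x, eball y rho x -> (Omega x <-> phi ((x - y) *m E^T) < edot u (x - y))].

Definition C2_boundary (R : realType) (n : nat) (Omega : set 'rV[R]_n.+1) :
    Prop :=
  forall y, boundary Omega y -> exists E u phi, local_graph Omega y E u phi.

(* Matrix of the Weingarten map of the graph of phi at (0, phi 0), for the unit
   normal (- p, 1) / sqrt (1 + |p|^2), where p is the gradient of phi at 0: in
   the parametrization z |-> (z, phi z) the first fundamental form is
   1 + p^T p and the second one is Hess phi / sqrt (1 + |p|^2).  In a
   local_graph this normal is the inner one, whence positive eigenvalues for a
   ball; if moreover p = 0 this is just Hess phi. *)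
Definition weingarten (R : realType) (n : nat) (phi : 'rV[R]_n -> R) : 'M[R]_n :=
  let p := gradient phi 0 in
  (Num.sqrt (1 + edot p p))^-1 *:
    (hessian phi 0 *m invmx (1%:M + p^T *m p)).

Definition principal_curvatures (R : realType) (n : nat)
    (Omega : set 'rV[R]_n.+1) (y : 'rV[R]_n.+1) (kappa : n.-tuple R) : Prop :=
  sorted <=%R kappa /\
  exists E u phi, local_graph Omega y E u phi /\
    char_poly (weingarten phi) = \prod_(k <- kappa) ('X - k%:P).

(* Here N = n.+1.  The usual kappa_1 <= ... <= kappa_{N-1} are indexed from 1:
   tnth kappa i is kappa_{i+1}.  As i < n = N - 1, a requirement whose index is
   N is void. *)
Definition condH (R : realType) (n : nat) (Omega : set 'rV[R]_n.+1) (j : nat) :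
    Prop :=
  forall y (kappa : n.-tuple R), boundary Omega y ->
    principal_curvatures Omega y kappa ->
    forall i : 'I_n, i.+1 = j \/ i.+1 = (n.+1 - j + 1)%N -> 0 < tnth kappa i.

Definition condFk (R : realType) (N : nat) (Omega : set 'rV[R]_N) (k : nat) :
    Prop :=
  forall y, boundary Omega y -> exists2 r : R, 0 < r &
    forall delta : R, 0 < delta ->
    exists (T : {vspace 'rV[R]_N}) (v : 'rV[R]_N) (lambda theta : R),
    [/\ \dim T = k, enorm v = 1, 0 < lambda, 0 < theta &
      let Tlambda :=
        [set x | edist x [set y + t | t in [set t | t \in T]] < lambda] in
      [set x | (Omega `&` eball y r `&` Tlambda) x /\ edot v (x - y) < theta]
        `<=` eball y delta].

Definition condGk (R : realType) (N : nat) (Omega : set 'rV[R]_N) (k : nat) :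
    Prop :=
  forall y, boundary Omega y -> forall r : R, 0 < r ->
    exists2 delta : R, 0 < delta &
    forall x, (eball y delta `&` Omega) x ->
    forall S : {vspace 'rV[R]_N}, \dim S = k ->
    exists v : 'rV[R]_N, [/\ v \in S, enorm v = 1 &
      [set x + t *: v | t in [set: R]] `&` eball y r `&` boundary Omega !=set0].

Definition condF (R : realType) (N : nat) (Omega : set 'rV[R]_N) (j : nat) :
    Prop :=
  condFk Omega j /\ condFk Omega (N - j + 1)%N.

Definition condG (R : realType) (N : nat) (Omega : set 'rV[R]_N) (j : nat) :
    Prop :=
  condGk Omega j /\ condGk Omega (N - j + 1)%N.

(* Main.v *)
Require Import Defs.
From mathcomp Require Import all_boot all_order all_algebra.
From mathcomp Require Import perm.
From mathcomp Require Import all_classical all_reals all_analysis.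
From mathcomp Require Import ring lra zify.
Set Implicit Arguments.
Unset Strict Implicit.
Unset Printing Implicit Defensive.
Import Order.TTheory GRing.Theory Num.Theory numFieldNormedType.Exports.
Local Open Scope classical_set_scope.
Local Open Scope ring_scope.

(** (H) implies (F): near [y] the set [Omega] is [{x | phi z < s}] in coordinates
    [x - y = z E + s u], with [phi 0 = 0] and gradient [p] at 0.  If
    [kappa_(N-k+1) > 0], the Hessian of [phi] at 0 is positive definite on a space
    [V] of dimension [k - 1].  Take [T = V E + R u] and for [v] the inner normal,
    proportional to [u - p E].  For [x] in [Omega] close to [T], the second order
    expansion gives [s - <p,z> > phi z - <p,z> >= c |z|^2 - small], so that
    [<v,x-y> < theta] forces [z], and then [s], to be small.  The curvatures
    are the eigenvalues of [hessian phi 0] relative to the Gram matrix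
    [1 + p^T p]; both matrices are diagonalized simultaneously.

    (F_k) implies (G_(N-k+1)): a subspace [S] of dimension [N - k + 1] meets [T] in
    a unit vector [w], which may be chosen with [<v,w> <= 0].  Starting at [x] near
    [y], the half-line [x + t w] keeps close to [y + T] and below the level
    [theta], so it has to leave [Omega] before reaching distance [r] from [y]. *)

(** * Euclidean norm *)

Section Euclidean.
Variables (R : realType) (m : nat).
Implicit Types (u v w : 'rV[R]_m) (a : R).

Lemma edotE u v : edot u v = \sum_i u 0 i * v 0 i.
Proof. by rewrite /edot mxE; apply: eq_bigr => i _; rewrite mxE. Qed.

Lemma edotC u v : edot u v = edot v u.
Proof. by rewrite !edotE; apply: eq_bigr => i _; rewrite mulrC. Qed.

Lemma edotDl u v w : edot (u + v) w = edot u w + edot v w.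
Proof. by rewrite /edot mulmxDl mxE. Qed.

Lemma edotZl a u v : edot (a *: u) v = a * edot u v.
Proof. by rewrite /edot -scalemxAl mxE. Qed.

Lemma edotDr u v w : edot w (u + v) = edot w u + edot w v.
Proof. by rewrite edotC edotDl !(edotC w). Qed.

Lemma edotZr a u v : edot u (a *: v) = a * edot u v.
Proof. by rewrite edotC edotZl edotC. Qed.

Lemma edotNl u v : edot (- u) v = - edot u v.
Proof. by rewrite -scaleN1r edotZl mulN1r. Qed.

Lemma edotNr u v : edot u (- v) = - edot u v.
Proof. by rewrite edotC edotNl edotC. Qed.

Lemma edot_ge0 u : 0 <= edot u u.
Proof. by rewrite edotE; apply: sumr_ge0 => i _; rewrite -expr2 sqr_ge0. Qed.

Lemma edot_eq0 u : edot u u = 0 -> u = 0.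
Proof.
rewrite edotE => /eqP; rewrite psumr_eq0; last first.
  by move=> i _; rewrite -expr2 sqr_ge0.
move=> /allP u0; apply/rowP => i; rewrite mxE.
have := u0 i; rewrite mem_index_enum -expr2 sqrf_eq0 => /(_ isT) /eqP.
by [].
Qed.

Lemma enorm_ge0 u : 0 <= enorm u.
Proof. exact: sqrtr_ge0. Qed.

Lemma enorm_sqr u : enorm u ^+ 2 = edot u u.
Proof. by rewrite sqr_sqrtr ?edot_ge0. Qed.

Lemma enorm0 : enorm (0 : 'rV[R]_m) = 0.
Proof. by rewrite /enorm /edot mul0mx mxE sqrtr0. Qed.

Lemma enorm_eq0 u : enorm u = 0 -> u = 0.
Proof. by move=> u0; apply: edot_eq0; rewrite -enorm_sqr u0 expr0n. Qed.

Lemma enormZ a u : enorm (a *: u) = `|a| * enorm u.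
Proof.
by rewrite /enorm edotZl edotZr mulrA -expr2 sqrtrM ?sqr_ge0 // sqrtr_sqr.
Qed.

Lemma enormN u : enorm (- u) = enorm u.
Proof. by rewrite -scaleN1r enormZ normrN1 mul1r. Qed.

Lemma edot_CauchySchwarz u v : `|edot u v| <= enorm u * enorm v.
Proof.
have [->|v0] := eqVneq v 0.
  by rewrite enorm0 mulr0 /edot trmx0 mulmx0 mxE normr0.
have vv : 0 < edot v v.
  rewrite lt_neqAle edot_ge0 andbT eq_sym.
  by apply: contra_neq v0 => /edot_eq0.
rewrite -(@ler_pXn2r _ 2) ?nnegrE ?mulr_ge0 ?enorm_ge0 //.
rewrite exprMn !enorm_sqr real_normK ?num_real //.
(* Expanded, this square norm is [|v|^2 (|u|^2 |v|^2 - <u,v>^2)]. *)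
have := edot_ge0 (edot v v *: u - edot u v *: v).
rewrite edotDl edotNl !edotDr !edotNr !edotZl !edotZr (edotC v u).
set a := edot u u; set b := edot u v; set c := edot v v => h.
have : 0 <= c * (a * c - b ^+ 2) by rewrite expr2; lra.
by rewrite pmulr_rge0 // subr_ge0.
Qed.

Lemma ler_enormD u v : enorm (u + v) <= enorm u + enorm v.
Proof.
rewrite -(@ler_pXn2r _ 2) ?nnegrE ?addr_ge0 ?enorm_ge0 //.
rewrite sqrrD !enorm_sqr edotDl !edotDr (edotC v u).
have := le_trans (ler_norm _) (edot_CauchySchwarz u v).
lra.
Qed.

Lemma enorm_coord u i : `|u 0 i| <= enorm u.
Proof.
rewrite -(@ler_pXn2r _ 2) ?nnegrE ?enorm_ge0 // enorm_sqr real_normK ?num_real //.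
rewrite edotE (bigD1 i) //= -expr2 lerDl sumr_ge0 // => k _.
by rewrite -expr2 sqr_ge0.
Qed.

(** Continuity and boundedness refer to the sup norm; Euclidean smallness passes to them through
    this inequality. *)
Lemma norm_le_enorm u : `|u| <= enorm u.
Proof.
rewrite [`|u|]mx_normrE; elim/big_ind: _ => [|x y|[i j] _] /=.
- exact: enorm_ge0.
- by rewrite ge_max => -> ->.
- by rewrite ord1 enorm_coord.
Qed.

End Euclidean.

Lemma enorm_mulmx (R : realType) (m n : nat) (A : 'M[R]_(m, n)) :
  exists2 K : R, 0 < K & forall c, enorm (c *m A) <= K * enorm c.
Proof.
exists (1 + \sum_i enorm (row i A)).
  by rewrite ltr_pwDl // sumr_ge0 // => i _; exact: enorm_ge0.
move=> c; rewrite mulmx_sum_row.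
rewrite mulrDl mul1r mulr_suml.
apply: (@le_trans _ _ (\sum_i enorm (row i A) * enorm c)); last first.
  by rewrite lerDr enorm_ge0.
elim/big_ind2: _ => [|x1 x2 y1 y2 h1 h2|i _].
- by rewrite enorm0.
- exact: le_trans (ler_enormD _ _) (lerD h1 h2).
- by rewrite enormZ mulrC ler_wpM2l ?enorm_ge0 ?enorm_coord.
Qed.

Lemma edot_mulmx (R : realType) (m n : nat) (A : 'M[R]_(m, n))
  (x : 'rV[R]_m) (y : 'rV[R]_n) : edot (x *m A) y = edot x (y *m A^T).
Proof. by rewrite /edot trmx_mul trmxK mulmxA. Qed.

Lemma enorm_mulmx_isometry (R : realType) (m n : nat) (E : 'M[R]_(m, n)) (c : 'rV[R]_m) :
  E *m E^T = 1%:M -> enorm (c *m E) = enorm c.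
Proof. by move=> EE; rewrite /enorm edot_mulmx -mulmxA EE mulmx1. Qed.

(** * From (F) to (G) *)

(** Since [A] misses [boundary U], it meets [U] and [closure U] in the same set, which is therefore
    both open and closed in [A]. *)
Lemma connected_sub_open (T : topologicalType) (A U : set T) :
  connected A -> open U -> A `&` U !=set0 -> A `&` boundary U = set0 ->
  A `<=` U.
Proof.
move=> cA oU AU AB.
have <- : A `&` U = A; last by move=> x [].
apply: cA => //; first by exists U.
exists (closure U); first exact: closed_closure.
apply/seteqP; split=> x [Ax Ux]; split=> //; first exact: subset_closure.
apply: contrapT => nUx; have : (A `&` boundary U) x; last by rewrite AB.
by split=> //; split=> // /interior_subset.
Qed.

Lemma edist_lt (R : realType) (m : nat) (x : 'rV[R]_m) (A : set 'rV[R]_m) l a :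
  A a -> enorm (x - a) < l -> Defs.edist x A < l.
Proof.
move=> Aa; apply: le_lt_trans; apply: ge_inf; last by exists a.
by exists 0 => _ [b _ <-]; exact: enorm_ge0.
Qed.

Lemma ltr_edist (R : realType) (m : nat) (x : 'rV[R]_m) (A : set 'rV[R]_m) l :
  A !=set0 -> Defs.edist x A < l -> exists2 a, A a & enorm (x - a) < l.
Proof.
move=> [a Aa] /inf_lt[]; first by exists (enorm (x - a)), a.
by move=> _ [b Ab <-] ?; exists b.
Qed.

Lemma continuous_line (R : realType) (m : nat) (x v : 'rV[R]_m) :
  continuous (fun t : R => x + t *: v).
Proof.
by move=> t; apply: cvgD; [exact: cvg_cst | apply: cvgZl].
Qed.

Lemma vspaceI_unit (R : realType) (m : nat) (S T : {vspace 'rV[R]_m}) :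
  (m < \dim S + \dim T)%N -> exists v, [/\ v \in S, v \in T & enorm v = 1].
Proof.
move=> ST; set w := vpick (S :&: T)%VS.
have w0 : w != 0.
  rewrite vpick0 -dimv_eq0 -lt0n.
  have := dimvS (subvf (S + T)%VS); rewrite dimvf /dim /= mul1n => h.
  by have := dimv_sum_cap S T; lia.
have nw : enorm w != 0 by apply: contra_neq w0 => /enorm_eq0.
have : w \in (S :&: T)%VS by exact: memv_pick.
rewrite memv_cap => /andP[wS wT]; exists ((enorm w)^-1 *: w).
by split; rewrite ?memvZ // enormZ ger0_norm ?invr_ge0 ?enorm_ge0 // mulVf.
Qed.

Lemma condFk_condGk (R : realType) (N : nat) (Omega : set 'rV[R]_N) (k l : nat) :
  open Omega -> (N < k + l)%N -> condFk Omega k -> condGk Omega l.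
Proof.
move=> oO Nkl F y yO r r0; have [r1 r10 {}F] := F y yO.
set q := Num.min r r1.
have q0 : 0 < q by rewrite lt_min r0.
(* The segment followed below starts within [q / 8] of [y] and has length [3 / 4 * q]: it stays in
   the ball of radius [q] but ends farther than [q / 2] from [y]. *)
have [T [v [lam [th [dT v1 lam0 th0 {}F]]]]] := F (q / 2) ltac:(lra).
exists (Num.min (Num.min lam th) (q / 8)).
  by rewrite !lt_min lam0 th0 divr_gt0.
move=> x [xy xO] S dS.
have [w0 [w0S w0T w01]] : exists v, [/\ v \in S, v \in T & enorm v = 1].
  by apply: vspaceI_unit; rewrite dS dT addnC.
(* Up to a change of sign, [<v, .>] does not increase along the half-line directed by the common
   vector. *)
have [w [wS wT w1 vw]] : exists w, [/\ w \in S, w \in T, enorm w = 1 & edot v w <= 0].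
  have [h|h] := leP (edot v w0) 0; first by exists w0.
  by exists (- w0); rewrite !memvN enormN edotNr oppr_le0 (ltW h).
exists w; split=> //; apply: contrapT => no.
move: xy; rewrite /eball /= !lt_min => /andP[/andP[xlam xth] xq].
have near t : 0 <= t <= 3 / 4 * q -> enorm (x + t *: w - y) < q.
  move=> /andP[t0 tq]; rewrite addrAC.
  apply: le_lt_trans (ler_enormD _ _) _; rewrite enormZ w1 ger0_norm //; lra.
(* By [no] the segment meets no boundary point, so it cannot leave [Omega]. *)
have sub : [set x + t *: w | t in `[0, 3 / 4 * q]] `<=` Omega.
  apply: connected_sub_open => //.
  - apply: connected_continuous_connected; first exact: segment_connected.
    by apply: continuous_subspaceT; exact: continuous_line.
  - exists x; split=> //; exists 0; last by rewrite scale0r addr0.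
    by rewrite /= in_itv /= lexx; lra.
  - rewrite -subset0 => _ [[t /= tq <-] tB]; apply: no.
    exists (x + t *: w); split=> //; split; first by exists t.
    rewrite /eball /=; apply: lt_le_trans (near t _) _.
      by move: tq; rewrite in_itv.
    by rewrite ge_min lexx.
have tq : 0 <= 3 / 4 * q <= 3 / 4 * q by rewrite lexx andbT; lra.
have e : x + (3 / 4 * q) *: w - y = (x - y) + (3 / 4 * q) *: w by rewrite addrAC.
(* The endpoint meets every requirement of (F_k), hence would lie within [q / 2] of [y], against the
   reverse triangle inequality. *)
suff /F : (Omega `&` eball y r1 `&`
    [set x' | Defs.edist x' [set y + t | t in [set t | t \in T]] < lam])
    (x + (3 / 4 * q) *: w) /\ edot v (x + (3 / 4 * q) *: w - y) < th.
  rewrite /eball /= e; apply/negP; rewrite -leNgt.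
  have := ler_enormD ((x - y) + (3 / 4 * q) *: w) (- (x - y)).
  rewrite addrC addKr enormN enormZ w1 ger0_norm; lra.
split; last first.
  rewrite e edotDr edotZr.
  have := le_trans (ler_norm _) (edot_CauchySchwarz v (x - y)).
  rewrite v1 mul1r => h.
  have : 3 / 4 * q * edot v w <= 0 by apply: mulr_ge0_le0 => //; lra.
  lra.
split; first split.
- by apply: sub; exists (3 / 4 * q) => //=; rewrite in_itv.
- by have := near _ tq; rewrite lt_min => /andP[].
- apply: (@edist_lt _ _ _ _ _ (y + (3 / 4 * q) *: w)).
    by exists ((3 / 4 * q) *: w) => //=; exact: memvZ.
  by rewrite opprD addrA addrAC addrK.
Qed.

(** * Spectral theorem and principal curvatures *)

Lemma continuous_quadratic (R : realType) (m : nat) (A : 'M[R]_m) :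
  continuous (fun x : 'rV[R]_m => edot (x *m A) x).
Proof.
have -> : (fun x : 'rV[R]_m => edot (x *m A) x) =
          (fun x => \sum_k (\sum_i x 0 i * A i k) * x 0 k).
  by apply/funext => x; rewrite edotE; apply: eq_bigr => k _; rewrite mxE.
move=> x; apply: (@cvg_big R _ +%R); [exact: add_continuous|exact: nbhs_filter|].
move=> k _.
apply: (@continuousM R _ (fun x : 'rV[R]_m => \sum_i x 0 i * A i k) (fun x => x 0 k)).
  apply: (@cvg_big R _ +%R); [exact: add_continuous|exact: nbhs_filter|].
  move=> i _; apply: (@continuousM R _ (fun x : 'rV[R]_m => x 0 i) (fun=> A i k)).
    exact: coord_continuous.
  exact: cst_continuous.
exact: coord_continuous.
Qed.

Lemma continuous_edot (R : realType) (m : nat) :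
  continuous (fun x : 'rV[R]_m => edot x x).
Proof.
have -> : (fun x : 'rV[R]_m => edot x x) = (fun x => edot (x *m 1%:M) x).
  by apply/funext => x; rewrite mulmx1.
exact: continuous_quadratic.
Qed.

(** A maximizer of the quadratic form on the unit sphere, which exists by compactness, is an
    eigenvector for the maximal value. *)
Lemma symmetric_eigenvector (R : realType) (n : nat) (A : 'M[R]_n.+1) :
  A^T = A -> exists v a, edot v v = 1 /\ v *m A = a *: v.
Proof.
move=> symA.
pose S : set 'rV[R]_n.+1 := [set x | edot x x = 1].
have S0 : S !=set0.
  exists (delta_mx 0 0); rewrite /S /= edotE (bigD1 0) //= big1 => [|i /negbTE i0].
    by rewrite !mxE !eqxx mulr1 addr0.
  by rewrite !mxE i0 andbF mulr0.
have cS : compact S.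
  apply: bounded_closed_compact.
    exists 1; split=> // M M1 x Sx /=.
    apply: le_trans (norm_le_enorm x) _.
    by rewrite /enorm Sx sqrtr1 ltW.
  rewrite /S; apply: (@closed_comp _ _ (fun x => edot x x) [set 1]).
    by move=> x _; exact: continuous_edot.
  exact: closed_eq.
have [v vS vmax] := EVT_max_rV S0 cS
  (continuous_subspaceT (@continuous_quadratic R n.+1 A)).
have {vS} vS : edot v v = 1 by move: vS; rewrite inE.
set a := edot (v *m A) v in vmax.
exists v, a; split=> //.
have max y : edot (y *m A) y <= a * edot y y.
  have [->|y0] := eqVneq y 0; first by rewrite mul0mx /edot mul0mx mxE mulr0.
  have ny : 0 < enorm y.
    by rewrite lt_neqAle enorm_ge0 andbT eq_sym; apply: contra_neq y0 => /enorm_eq0.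
  have := vmax ((enorm y)^-1 *: y).
  rewrite inE /S /= -scalemxAl !edotZl !edotZr -enorm_sqr !mulrA -expr2 => h.
  have {}h := h ltac:(by rewrite -mulrA -expr2 -exprMn mulVf ?expr1n ?gt_eqF).
  by rewrite exprVn ler_pdivrMl ?exprn_gt0 // mulrC expr2 mulrA in h.
pose w := a *: v - v *m A.
have symAdot x y : edot (x *m A) y = edot (y *m A) x.
  by rewrite edotC edot_mulmx symA edotC edot_mulmx symA edotC.
suff /edot_eq0 /eqP : edot w w = 0 by rewrite subr_eq0 => /eqP.
have b0 : 0 <= a * edot w w - edot (w *m A) w by rewrite subr_ge0 max.
(* The form a<y,y> - <yA,y> is nonnegative and vanishes at v, so its
   derivative at v in the direction w, namely 2<w,w>, vanishes. *)
have ww : edot w w = a * edot v w - edot (v *m A) w by rewrite {1}/w edotDl edotZl edotNl.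
clearbody w.
have key t : 0 <= t ^+ 2 * (a * edot w w - edot (w *m A) w) +
    2 * t * (a * edot v w - edot (v *m A) w).
  have := max (v + t *: w); rewrite -subr_ge0 mulmxDl -scalemxAl.
  rewrite !edotDl !edotDr !edotZl !edotZr (symAdot w v) (edotC w v) vS -/a.
  move=> h. lra.
move: b0 key; rewrite -ww; set b := _ - _; set c := edot w w => b0 key.
have c0 : 0 <= c by exact: edot_ge0.
have b1 : 0 < b + 1 by lra.
have b2 : 0 < (b + 1) ^+ 2 by rewrite exprn_gt0.
(* A nearly minimizing [t]; dividing by [b + 1] instead of [b] covers [b = 0]. The value is a
   negative multiple of [c ^+ 2], so [c = 0]. *)
have := key (- c / (b + 1)); rewrite -(pmulr_rge0 _ b2).
have -> : (b + 1) ^+ 2 * ((- c / (b + 1)) ^+ 2 * b + 2 * (- c / (b + 1)) * c) =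
   - ((b + 2) * c ^+ 2) by field; rewrite gt_eqF.
rewrite oppr_ge0 pmulr_rle0; last lra.
by move=> h; apply/eqP; rewrite -sqrf_eq0 eq_le h sqr_ge0.
Qed.

Lemma orthogonal_first_row (R : realType) (n : nat) (v : 'rV[R]_n.+1) :
  edot v v = 1 -> exists Q : 'M[R]_n.+1, Q *m Q^T = 1%:M /\ delta_mx 0 0 *m Q = v.
Proof.
(* the Householder reflection exchanging the first basis vector and v *)
move=> v1; set e : 'rV[R]_n.+1 := delta_mx 0 0.
have e1 : edot e e = 1.
  by rewrite /edot /e trmx_delta mul_delta_mx mxE !eqxx.
have [->|ve] := eqVneq v e; first by exists 1%:M; rewrite trmx1 !mulmx1.
pose w := v - e; pose c := 2 / edot w w.
have w0 : edot w w != 0 by apply: contra_neq ve => /edot_eq0 /eqP; rewrite subr_eq0 => /eqP.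
have ww : w *m w^T = (edot w w)%:M by rewrite [LHS]mx11_scalar.
pose Q : 'M[R]_n.+1 := 1%:M - c *: (w^T *m w).
have QT : Q^T = Q by rewrite /Q linearB /= linearZ /= trmx1 trmx_mul trmxK.
exists Q; rewrite QT; split.
  rewrite {2}/Q mulmxBr mulmx1 {1}/Q -scalemxAr mulmxBl mul1mx.
  rewrite -scalemxAl -mulmxA (mulmxA w) ww mul_scalar_mx -scalemxAr scalerA.
  rewrite /c divfK // scalerBr scalerDl scale1r /Q.
  by apply/matrixP => i j; rewrite !mxE; ring.
have ew : e *m w^T = (edot e w)%:M by rewrite [LHS]mx11_scalar.
rewrite /Q mulmxBr mulmx1 -scalemxAr mulmxA ew mul_scalar_mx scalerA.
(* As [v] and [e] are both unit vectors, [<w,w> = - 2 <e,w>]. *)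
have -> : c * edot e w = -1.
  have e2 : edot w w = - 2 * edot e w.
    by rewrite /w !edotDl !edotDr !edotNl !edotNr v1 e1 (edotC v e); ring.
  rewrite /c e2; field.
  by apply: contra_neq w0 => h; rewrite e2 h mulr0.
by rewrite scaleN1r opprK addrC subrK.
Qed.

(** By induction: in an orthonormal basis starting with an eigenvector, symmetry makes the matrix
    block diagonal, and the lower block is again symmetric. *)
Lemma symmetric_diagonalizable (R : realType) (n : nat) (A : 'M[R]_n) :
  A^T = A -> exists (P : 'M[R]_n) (d : 'rV[R]_n),
    P *m P^T = 1%:M /\ P *m A *m P^T = diag_mx d.
Proof.
elim: n A => [|n IH] A symA.
  by exists 1%:M, 0; rewrite trmx1 mulmx1; split=> //; apply/matrixP => -[].
have [v [a [v1 vA]]] := symmetric_eigenvector symA.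
have [Q [QQ eQ]] := orthogonal_first_row v1.
pose B : 'M[R]_(1 + n) := Q *m A *m Q^T.
have symB : B^T = B by rewrite /B !trmx_mul trmxK symA mulmxA.
have eB : (delta_mx 0 0 : 'rV[R]_(1 + n)) *m B = a *: delta_mx 0 0.
  by rewrite /B !mulmxA eQ vA -scalemxAl -eQ -mulmxA QQ mulmx1.
have BE : Q *m A *m Q^T = B by [].
clearbody B.
have B0 j : B 0 j = a * (j == 0)%:R.
  move/matrixP: eB => /(_ 0 j); rewrite -rowE !mxE eqxx /= => ->.
  by [].
have dB : B = block_mx a%:M 0 0 (drsubmx B).
  rewrite -[LHS]submxK; congr block_mx.
  - by apply/matrixP => i j; rewrite !ord1 !mxE lshift0 B0 !eqxx mulr1 mulr1n.
  - by apply/matrixP => i j; rewrite ord1 !mxE lshift0 B0 rshift1 mulr0.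
  - apply/matrixP => i j; rewrite ord1 !mxE lshift0 -symB mxE B0 rshift1.
    by rewrite mulr0.
have [P [d [PP PB]]] : exists (P : 'M[R]_n) (d : 'rV[R]_n),
    P *m P^T = 1%:M /\ P *m drsubmx B *m P^T = diag_mx d.
  by apply: IH; rewrite trmx_drsub symB.
pose P1 : 'M[R]_(1 + n) := block_mx 1%:M 0 0 P.
have P1T : P1^T = block_mx 1%:M 0 0 P^T.
  by rewrite /P1 tr_block_mx trmx1 !trmx0.
have P1P : P1 *m P1^T = 1%:M.
  rewrite P1T /P1 mulmx_block !mulmx0 !mul0mx !mulmx1 !addr0 !add0r PP.
  by rewrite -scalar_mx_block.
have PBP : P1 *m B *m P1^T = diag_mx (row_mx a%:M d).
  rewrite dB P1T /P1 !(mulmx_block, mulmx0, mul0mx, mul1mx, mulmx1, addr0, add0r).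
  rewrite PB diag_mx_row; congr block_mx.
  by apply/matrixP => i j; rewrite !ord1 !mxE.
exists (P1 *m Q), (row_mx a%:M d); split.
  by rewrite trmx_mul -mulmxA (mulmxA Q) QQ mul1mx P1P.
by rewrite -PBP -BE trmx_mul !mulmxA.
Qed.

(** The relation lifts to [X - A] over polynomials; taking determinants, the nonzero constant
    [det P] cancels. *)
Lemma char_poly_diagonalized (F : fieldType) (n : nat) (A P : 'M[F]_n) (d : 'rV[F]_n) :
  P \in unitmx -> P *m A = diag_mx d *m P ->
  char_poly A = \prod_i ('X - (d 0 i)%:P).
Proof.
move=> uP PA.
have -> : \prod_i ('X - (d 0 i)%:P) = char_poly (diag_mx d).
  rewrite char_poly_trig ?diag_mx_is_trig //.
  by apply: eq_bigr => i _; rewrite mxE eqxx mulr1n.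
pose P' := map_mx polyC P.
have PA' : P' *m char_poly_mx A = char_poly_mx (diag_mx d) *m P'.
  by rewrite mulmxBr mulmxBl -!map_mxM PA scalar_mxC.
have := congr1 determinant PA'; rewrite !det_mulmx mulrC.
apply: mulIf; rewrite det_map_mx polyC_eq0.
by move: uP; rewrite unitmxE unitfE.
Qed.

(* [S] is the inverse square root of the Gram matrix [1 + p^T p]. *)
Lemma inverse_sqrt_gram (R : realType) (n : nat) (p : 'rV[R]_n) :
  exists S : 'M[R]_n, S^T = S /\ S *m (1%:M + p^T *m p) *m S = 1%:M.
Proof.
set q := edot p p; pose s := Num.sqrt (1 + q).
have q0 : 0 <= q := edot_ge0 p.
have ss : s ^+ 2 = 1 + q by rewrite sqr_sqrtr ?addr_ge0.
have s0 : 0 < s by rewrite sqrtr_gt0 ltr_wpDr.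
(* [1 - k N] must be the identity orthogonally to [p] and [1 / s] along [p], so [k q = 1 - 1 / s].
   As [q = s^2 - 1], this form of [k] avoids dividing by [q], which may vanish. *)
pose k := (s * (1 + s))^-1; pose N := p^T *m p.
have NN : N *m N = q *: N.
  rewrite /N mulmxA -(mulmxA p^T) [p *m p^T]mx11_scalar mul_mx_scalar.
  by rewrite -scalemxAl.
exists (1%:M - k *: N); split.
  by rewrite linearB /= linearZ /= trmx1 /N trmx_mul trmxK.
rewrite mulmxDr mulmx1 -/N mulmxBl mul1mx -scalemxAl NN scalerA.
have -> : 1%:M - k *: N + (N - (k * q) *: N) = 1%:M + (1 - k * (1 + q)) *: N.
  by apply/matrixP => i j; rewrite !mxE; ring.
rewrite mulmxDl mul1mx mulmxBr mulmx1 -scalemxAl -scalemxAr NN !scalerA.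
set m := 1 - k * (1 + q).
transitivity (1%:M + (- k + m - m * k * q) *: N).
  by apply/matrixP => i j; rewrite !mxE; ring.
have -> : - k + m - m * k * q = 0; last by rewrite scale0r addr0.
have -> : q = s ^+ 2 - 1 by rewrite ss addrC addKr.
rewrite /m -ss /k; field.
by rewrite !gt_eqF ?addr_gt0.
Qed.

(** With [G] the Gram matrix and [G^-1 = S S], the matrix [H G^-1] is similar to the symmetric
    [S H S]. If the orthogonal [U] diagonalizes the latter, [P = U S] diagonalizes [H] by
    congruence, with the same diagonal. *)
Lemma principal_basis (R : realType) (n : nat) (H : 'M[R]_n) (p : 'rV[R]_n) :
  let s := Num.sqrt (1 + edot p p) in
  H^T = H -> exists (kappa : n.-tuple R) (P : 'M[R]_n),
  [/\ sorted <=%R kappa,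
      char_poly (s^-1 *: (H *m invmx (1%:M + p^T *m p))) =
        \prod_(k <- kappa) ('X - k%:P),
      P \in unitmx &
      P *m H *m P^T = diag_mx (\row_i (s * tnth kappa i))].
Proof.
move=> s symH; have [S [symS SGS]] := inverse_sqrt_gram p.
set G := 1%:M + p^T *m p in SGS *.
have s0 : 0 < s by rewrite sqrtr_gt0 ltr_wpDr // edot_ge0.
have [uS _] : S \in unitmx /\ G *m S \in unitmx.
  by apply: mulmx1_unit; rewrite mulmxA.
have [uG' _] := mulmx1_unit SGS.
have uG : G \in unitmx by move: uG'; rewrite unitmx_mul => /andP[].
have GV : invmx G = S *m S.
  have SS : G *m (S *m S) = 1%:M.
    apply: (can_inj (mulKmx uS)).
    by rewrite !mulmxA SGS mul1mx mulmx1.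
  by rewrite -[RHS](mulKmx uG) SS mulmx1.
have symA : (S *m H *m S)^T = S *m H *m S by rewrite !trmx_mul symS symH mulmxA.
have [U [d [UU UA]]] := symmetric_diagonalizable symA.
have [uU _] := mulmx1_unit UU.
have UU' : U^T *m U = 1%:M by exact: mulmx1C.
pose t := [tuple s^-1 * d 0 i | i < n].
(* The curvatures must come in increasing order, so the rows of [U *m S] are permuted
   accordingly. *)
have /tuple_permP[g gt] : perm_eq (sort <=%R t) t by rewrite perm_sort.
pose kappa := [tuple tnth t (g i) | i < n].
have uP : U *m S \in unitmx by rewrite unitmx_mul uU.
exists kappa, (row_perm g (U *m S)); split.
- by rewrite -gt; apply: sort_sorted; exact: le_total.
- rewrite (char_poly_diagonalized (P := U *m S) (d := s^-1 *: d)) //.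
    rewrite -gt (perm_big t) ?perm_sort //= big_map big_enum /=.
    by apply: eq_bigr => i _; rewrite mxE.
  rewrite -scalemxAr linearZ /= -scalemxAl GV; congr (_ *: _).
  by rewrite -UA -!mulmxA (mulmxA U^T) UU' mul1mx.
- by rewrite row_permE unitmx_mul unitmx_perm.
- have PHP : U *m S *m H *m (U *m S)^T = diag_mx d.
    by rewrite trmx_mul symS -UA !mulmxA.
  apply/matrixP => i j; move/matrixP: PHP => /(_ (g i) (g j)).
  rewrite !mxE (inj_eq perm_inj) !tnth_mktuple.
  have -> : s * (s^-1 * d 0 (g i)) = d 0 (g i) by rewrite mulVKf ?gt_eqF.
  move=> <-.
  apply: eq_bigr => k _; rewrite !mxE; congr (_ * _).
  by apply: eq_bigr => l _; rewrite !mxE.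
Qed.

(** * Second order calculus *)

Lemma continuous0_enorm (R : realType) (n : nat) (f : 'rV[R]_n -> R) :
  {for 0, continuous f} -> forall e, 0 < e ->
  exists2 d, 0 < d & forall x, enorm x < d -> `|f 0 - f x| < e.
Proof.
move=> /cvgrPdist_lt cf e /cf /nbhs_ballP[d d0 df]; exists d => // x xd.
apply: df; rewrite -ball_normE /ball_ /= sub0r normrN.
exact: le_lt_trans (norm_le_enorm x) xd.
Qed.

Lemma is_derive_line (R : realType) (n : nat) (f : 'rV[R]_n -> R) (z w : 'rV[R]_n) (t : R) :
  differentiable f (t *: z + w) ->
  is_derive t 1 (fun s => f (s *: z + w)) ('D_z f (t *: z + w)).
Proof.
move=> df.
have e : (fun h : R => h^-1 *: (((fun s => f (s *: z + w)) \o shift t) (h *: 1) -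
      f (t *: z + w))) =
    (fun h => h^-1 *: ((f \o shift (t *: z + w)) (h *: z) - f (t *: z + w))).
  by apply/funext => h /=; rewrite scalerDl addrA [h *: 1]mulr1.
split; last by rewrite /derive e.
by rewrite /derivable e; apply: diff_derivable.
Qed.

Lemma MVT_line (R : realType) (n : nat) (f : 'rV[R]_n -> R) (z w : 'rV[R]_n) (s : R) :
  (forall x, differentiable f x) -> 0 < s ->
  exists2 c, 0 < c < s & f (s *: z + w) - f w = s * 'D_z f (c *: z + w).
Proof.
move=> df s0.
have [|t|c] := @MVT R (fun t => f (t *: z + w)) (fun t => 'D_z f (t *: z + w)) 0 s s0.
- by move=> t _; exact: is_derive_line.
- apply: derivable_within_continuous => x _.
  by have [] := is_derive_line (df (x *: z + w)).
- rewrite in_itv /= => cs; rewrite scale0r add0r subr0 mulrC => E.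
  by exists c.
Qed.

(** Two applications of the mean value theorem: along [a] to the difference [g], then along [b] to
    ['D_a f]. *)
Lemma second_difference (R : realType) (n : nat) (f : 'rV[R]_n -> R) (a b : 'rV[R]_n) (s : R) :
  C2 f -> 0 < s -> exists c d, [/\ 0 < c < s, 0 < d < s &
    f (s *: a + s *: b) - f (s *: a) - f (s *: b) + f 0 =
    s ^+ 2 * 'D_b (fun x => 'D_a f x) (c *: a + d *: b)].
Proof.
move=> [[df _] D2] s0; have [dfa _] := D2 a.
pose g : R -> R := (fun t => f (t *: a + s *: b)) - (fun t => f (t *: a + 0)).
have dg (t : R) : is_derive t 1 g ('D_a f (t *: a + s *: b) - 'D_a f (t *: a + 0)).
  by apply: is_deriveB; exact: is_derive_line.
have [|c] := MVT s0 (fun t _ => dg t).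
  by apply: derivable_within_continuous => x _; have [] := dg x.
rewrite in_itv /= subr0 => cs gs.
have [d ds fd] := MVT_line b (c *: a) dfa s0.
exists c, d; split; [exact: cs|exact: ds|].
have gE t : g t = f (t *: a + s *: b) - f (t *: a + 0) by [].
move: gs; rewrite !gE !scale0r !add0r !addr0.
rewrite [c *: a + _]addrC fd [d *: b + _]addrC => gs.
rewrite expr2 -mulrA [s * (s * _)]mulrC -gs; ring.
Qed.

(** Divide both expressions of [G s] by [s ^+ 2] and let [s] tend to 0. This compares the two mixed
    derivatives, [G] being the second difference. *)
Lemma eq_of_scaled_values (R : realType) (n : nat) (F1 F2 : 'rV[R]_n -> R)
  (G : R -> R) (a b : 'rV[R]_n) :
  {for 0, continuous F1} -> {for 0, continuous F2} ->
  (forall s, 0 < s -> exists c d, [/\ 0 < c < s, 0 < d < s &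
    G s = s ^+ 2 * F1 (c *: a + d *: b)]) ->
  (forall s, 0 < s -> exists c d, [/\ 0 < c < s, 0 < d < s &
    G s = s ^+ 2 * F2 (c *: a + d *: b)]) ->
  F1 0 = F2 0.
Proof.
move=> c1 c2 G1 G2.
apply/eqP; rewrite -subr_eq0 -normr_eq0; apply/negPn/negP.
rewrite neq_lt ltNge normr_ge0 /=; set X := F1 0; set Y := F2 0 => XY.
have e0 : 0 < `|X - Y| / 2 by rewrite divr_gt0.
have [r1 r10 h1] := continuous0_enorm c1 e0.
have [r2 r20 h2] := continuous0_enorm c2 e0.
(* With [s K] the smaller radius, all sample points lie where both functions vary by less than half
   of the supposed gap. *)
pose K := 1 + enorm a + enorm b.
have K0 : 0 < K by rewrite /K -addrA ltr_pwDl // addr_ge0 ?enorm_ge0.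
pose s := Num.min r1 r2 / K.
have s0 : 0 < s by rewrite divr_gt0 // lt_min r10.
have small c d : 0 < c < s -> 0 < d < s -> enorm (c *: a + d *: b) < Num.min r1 r2.
  move=> /andP[c0 cs] /andP[d0 ds].
  apply: le_lt_trans (ler_enormD _ _) _; rewrite !enormZ !gtr0_norm //.
  have -> : Num.min r1 r2 = s * K by rewrite divfK ?gt_eqF.
  rewrite /K !mulrDr mulr1.
  have := ler_wpM2r (enorm_ge0 a) (ltW cs).
  have := ler_wpM2r (enorm_ge0 b) (ltW ds); lra.
have [c [d [cs ds E1]]] := G1 s s0.
have [c' [d' [cs' ds' E2]]] := G2 s s0.
have := small _ _ cs ds; rewrite lt_min => /andP[/h1 hX _].
have := small _ _ cs' ds'; rewrite lt_min => /andP[_ /h2 hY].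
have s2 : s ^+ 2 != 0 by rewrite expf_neq0 ?gt_eqF.
move: hX hY; rewrite -/X -/Y -(mulfI s2 (etrans (esym E1) E2)).
move: (F1 _) => x hX hY.
have := ler_distD x X Y; rewrite (distrC x Y); lra.
Qed.

(** Schwarz's theorem: the second difference is symmetric in [a] and [b]. *)
Lemma C2_derive_sym (R : realType) (n : nat) (f : 'rV[R]_n -> R) (a b : 'rV[R]_n) :
  C2 f -> 'D_b (fun x => 'D_a f x) 0 = 'D_a (fun x => 'D_b f x) 0.
Proof.
move=> C2f; have [_ D2] := C2f.
have [_ /(_ b) ca] := D2 a; have [_ /(_ a) cb] := D2 b.
apply: (@eq_of_scaled_values _ _ (fun x => 'D_b (fun x => 'D_a f x) x)
  (fun x => 'D_a (fun x => 'D_b f x) x)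
  (fun s => f (s *: a + s *: b) - f (s *: a) - f (s *: b) + f 0) a b).
- exact: ca.
- exact: cb.
- by move=> s; exact: second_difference.
- move=> s s0; have [c [d [cs ds E]]] := second_difference b a C2f s0.
  exists d, c; split; [exact: ds|exact: cs|].
  rewrite (addrC (d *: a)) -E (addrC (s *: b)).
  by rewrite -!addrA; congr (_ + _); rewrite addrCA.
Qed.

Lemma hessian_sym (R : realType) (n : nat) (f : 'rV[R]_n -> R) :
  C2 f -> (hessian f 0)^T = hessian f 0.
Proof. by move=> C2f; apply/matrixP => i k; rewrite !mxE; exact: C2_derive_sym. Qed.

Lemma derive_coord (R : realType) (n : nat) (f : 'rV[R]_n -> R) (z x : 'rV[R]_n) :
  differentiable f x -> 'D_z f x = \sum_i z 0 i * 'D_('e_i) f x.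
Proof.
move=> df; rewrite deriveE // {1}(row_sum_delta z) linear_sum.
by apply: eq_bigr => i _; rewrite linearZ deriveE.
Qed.

Lemma derive_gradient (R : realType) (n : nat) (f : 'rV[R]_n -> R) (z x : 'rV[R]_n) :
  differentiable f x -> 'D_z f x = edot (gradient f x) z.
Proof.
move=> df; rewrite derive_coord // edotC edotE.
by apply: eq_bigr => i _; rewrite mxE.
Qed.

Lemma derive2_hessian (R : realType) (n : nat) (f : 'rV[R]_n -> R) (z x : 'rV[R]_n) :
  C2 f -> 'D_z (fun y => 'D_z f y) x = edot (z *m hessian f x) z.
Proof.
move=> [[df _] D2].
have -> : (fun y => 'D_z f y) = \sum_k (z 0 k *: (fun y => 'D_('e_k) f y)).
  by apply/funext => y; rewrite derive_coord // fct_sumE.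
have dk k v : derivable (fun y => 'D_('e_k) f y) x v.
  by have [d _] := D2 'e_k; apply: diff_derivable.
rewrite derive_sum; last by move=> k; apply: derivableZ.
rewrite edotE; apply: eq_bigr => k _.
rewrite deriveZ //= mulrC; congr (_ * _); rewrite mxE derive_coord; last first.
  by have [] := D2 'e_k.
by apply: eq_bigr => i _; rewrite mxE.
Qed.

Lemma taylor2_lower (R : realType) (n : nat) (f : 'rV[R]_n -> R) (z : 'rV[R]_n) (m : R) :
  C2 f -> (forall t, 0 < t < 1 -> m <= 'D_z (fun x => 'D_z f x) (t *: z)) ->
  f 0 + 'D_z f 0 + m / 2 <= f z.
Proof.
move=> [[df _] D2] hm; have [dfz _] := D2 z.
pose D0 := 'D_z f 0.
(* The remainder along the segment; its derivative is nonnegative by a second mean value argument,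
   so [k 0 <= k 1]. *)
pose k : R -> R := (fun t => f (t *: z + 0)) - (cst D0 * id) - (cst (m / 2) * (id ^+ 2) : R -> R).
have dk (t : R) : is_derive t 1 k ('D_z f (t *: z + 0) - D0 - m * t).
  have h := is_derive_line (df (t *: z + 0)).
  apply: is_derive_eq.
  rewrite !scaler0 !addr0 /= expr1 ![_%:A]mulr1.
  by congr (_ - _); rewrite -[LHS]/(m / 2 * (2 * t)); field.
have [|c] := MVT ltr01 (fun t _ => dk t).
  by apply: derivable_within_continuous => x _; have [] := dk x.
rewrite in_itv /= subr0 mulr1 => /andP[c0 c1].
have kE t : k t = f (t *: z + 0) - D0 * t - m / 2 * t ^+ 2 by [].
have [d /andP[d0 dc] ->] := MVT_line z 0 dfz c0.
have : m <= 'D_z (fun x => 'D_z f x) (d *: z).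
  by apply: hm; rewrite d0 (lt_trans dc).
rewrite !kE !addr0 scale0r scale1r; set M := 'D_z _ (d *: z) => mM.
have : 0 <= c * (M - m) by rewrite mulr_ge0 ?subr_ge0 // ltW.
rewrite expr1n expr0n /= -/D0. lra.
Qed.

Lemma quadratic_form_close (R : realType) (n : nat) (A B : 'M[R]_n) (z : 'rV[R]_n) (e : R) :
  (forall i k, `|A i k - B i k| <= e) ->
  edot (z *m A) z - edot (z *m B) z <= (n * n)%:R * e * enorm z ^+ 2.
Proof.
move=> AB.
have -> : edot (z *m A) z - edot (z *m B) z =
   \sum_k \sum_i z 0 i * (A i k - B i k) * z 0 k.
  rewrite !edotE -sumrB; apply: eq_bigr => k _; rewrite !mxE.
  rewrite -mulrBl -sumrB mulr_suml; apply: eq_bigr => i _.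
  by rewrite -mulrBr.
have entry i k : z 0 i * (A i k - B i k) * z 0 k <= e * enorm z ^+ 2.
  apply: le_trans (ler_norm _) _; rewrite !normrM mulrAC mulrC.
  apply: ler_pM; rewrite ?mulr_ge0 //.
  by rewrite expr2 ler_pM ?enorm_coord.
apply: (@le_trans _ _ (\sum_(k < n) \sum_(i < n) e * enorm z ^+ 2)).
  by apply: ler_sum => k _; apply: ler_sum => i _; exact: entry.
by rewrite !sumr_const !card_ord -mulrnA -[leLHS]mulr_natl [leLHS]mulrA.
Qed.

Lemma continuous_hessian (R : realType) (n : nat) (f : 'rV[R]_n -> R) i k :
  C2 f -> {for 0, continuous (fun x => hessian f x i k)}.
Proof.
move=> [_ D2]; have [_ /(_ 'e_i 0)] := D2 'e_k.
have -> // : (fun x => hessian f x i k) = (fun x => 'D_('e_i) (fun z => 'D_('e_k) f z) x).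
by apply/funext => x; rewrite mxE.
Qed.

(** Near 0 the Hessian is close to its value at 0, so second derivatives along the segment to [z]
    drop by at most [2 * e * |z|^2]. A lower bound suffices, since [Omega] lies above the graph. *)
Lemma taylor2_peano_lower (R : realType) (n : nat) (f : 'rV[R]_n -> R) (e : R) :
  C2 f -> 0 < e -> exists2 r, 0 < r & forall z, enorm z < r ->
    f 0 + edot (gradient f 0) z + edot (z *m hessian f 0) z / 2 - e * enorm z ^+ 2
      <= f z.
Proof.
move=> C2f e0; have [[df _] D2] := C2f.
pose e1 := e / (1 + (n * n)%:R).
have n0 : 0 < 1 + (n * n)%:R :> R by rewrite ltr_pwDl.
have e10 : 0 < e1 by rewrite divr_gt0.
have : \forall x \near (0 : 'rV[R]_n), forall i k,
    `|hessian f 0 i k - hessian f x i k| < e1.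
  apply: (@filter_forall _ _ (fun i x => forall k, `|hessian f 0 i k - hessian f x i k| < e1)
    _ (nbhs_filter (0 : 'rV[R]_n))) => i.
  apply: (@filter_forall _ _ (fun k x => `|hessian f 0 i k - hessian f x i k| < e1)
    _ (nbhs_filter (0 : 'rV[R]_n))) => k.
  by have /cvgrPdist_lt/(_ e1 e10) := continuous_hessian (i := i) (k := k) C2f.
move=> /nbhs_ballP[r r0 hr]; exists r => // z zr.
have hess t : 0 < t < 1 -> edot (z *m hessian f 0) z - 2 * e * enorm z ^+ 2 <=
    'D_z (fun x => 'D_z f x) (t *: z).
  move=> /andP[t0 t1]; rewrite derive2_hessian // lerBlDl -lerBlDr.
  have /hr {}hr : ball (0 : 'rV[R]_n) r (t *: z).
    rewrite -ball_normE /ball_ /= sub0r normrN.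
    apply: le_lt_trans (norm_le_enorm _) _; rewrite enormZ gtr0_norm //.
    by apply: le_lt_trans zr; rewrite ler_piMl ?enorm_ge0 // ltW.
  apply: le_trans (quadratic_form_close z (fun i k => ltW (hr i k))) _.
  apply: ler_wpM2r; first exact: exprn_ge0 (enorm_ge0 z).
  rewrite /e1 mulrCA [2 * e]mulrC ler_pM2l // ler_pdivrMr //; lra.
have := taylor2_lower C2f hess; rewrite derive_gradient //; lra.
Qed.

(** * From (H) to (F) *)

(** Continuity of [x |-> <x,x>] at 0 compares Euclidean balls with sup-norm ones. *)
Lemma nbhs_eball (R : realType) (m : nat) (y : 'rV[R]_m) (r : R) :
  0 < r -> nbhs y (eball y r).
Proof.
move=> r0; have := @continuous_edot R m 0 => /cvgrPdist_lt/(_ (r ^+ 2)).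
rewrite exprn_gt0 // => /(_ isT)/nbhs_ballP[e e0 he].
apply/nbhs_ballP; exists e => // x; rewrite -ball_normE /ball_ /= => xy.
have /he : ball (0 : 'rV[R]_m) e (x - y).
  by rewrite -ball_normE /ball_ /= sub0r opprB.
rewrite /= -!enorm_sqr enorm0 expr0n /= sub0r normrN ger0_norm ?sqr_ge0 //.
by rewrite ltr_pXn2r ?nnegrE ?enorm_ge0 ?ltW.
Qed.

(** * Coordinates in an orthonormal frame *)

Section Frame.
Variables (R : realType) (n : nat) (E : 'M[R]_(n, n.+1)) (u : 'rV[R]_n.+1).
Hypotheses (EE : E *m E^T = 1%:M) (Eu : E *m u^T = 0) (u1 : enorm u = 1).

Lemma frame_axis : u *m E^T = 0.
Proof. by rewrite -[LHS]trmxK trmx_mul trmxK Eu trmx0. Qed.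

Lemma frame_axis_unit : u *m u^T = 1%:M.
Proof.
rewrite [LHS]mx11_scalar; congr (_%:M).
by rewrite -[LHS]/(edot u u) -enorm_sqr u1 expr1n.
Qed.

Lemma frame_decomposition (w : 'rV[R]_n.+1) :
  w = edot u w *: u + w *m E^T *m E.
Proof.
pose M : 'M[R]_(1 + n) := col_mx u E.
have MM : M *m M^T = 1%:M.
  rewrite /M tr_col_mx mul_col_row frame_axis_unit frame_axis Eu EE.
  by rewrite -scalar_mx_block.
(* The rows [u], [E] form a square matrix with orthonormal rows, so its columns are orthonormal
   too. *)
have : w *m (M^T *m M) = w by rewrite (mulmx1C MM) mulmx1.
rewrite /M tr_col_mx mul_row_col mulmxDr !mulmxA [w *m u^T]mx11_scalar.
by rewrite mul_scalar_mx -[(w *m u^T) 0 0]/(edot w u) edotC => {1}<-.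
Qed.

Lemma frame_pythagoras (w : 'rV[R]_n.+1) :
  edot w w = edot u w ^+ 2 + edot (w *m E^T) (w *m E^T).
Proof.
rewrite {1}(frame_decomposition w) edotDl edotZl -expr2; congr (_ + _).
by rewrite edot_mulmx.
Qed.

Lemma frame_proj_le (w : 'rV[R]_n.+1) : enorm (w *m E^T) <= enorm w.
Proof. by rewrite ler_wsqrtr // (frame_pythagoras w) lerDr sqr_ge0. Qed.

Lemma frame_enorm_le (w : 'rV[R]_n.+1) :
  enorm w <= `|edot u w| + enorm (w *m E^T).
Proof.
rewrite {1}(frame_decomposition w); apply: le_trans (ler_enormD _ _) _.
by rewrite enormZ u1 mulr1 enorm_mulmx_isometry.
Qed.

End Frame.

(** By continuity, [phi 0 < 0] would make [y] interior to [Omega], and [phi 0 > 0] would keep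
    [Omega] away from [y]. *)
Lemma local_graph_origin (R : realType) (n : nat) (Omega : set 'rV[R]_n.+1)
    y E u phi :
  local_graph Omega y E u phi -> boundary Omega y -> phi 0 = 0.
Proof.
move=> [EE Eu u1 [[dphi _] _] [rho rho0 graph]] [cy ny].
have cphi : {for 0, continuous phi} by apply: differentiable_continuous.
apply/eqP/negPn/negP => phi0.
have e0 : 0 < `|phi 0| / 2 by rewrite divr_gt0 ?normr_gt0.
have [d d0 hd] := continuous0_enorm cphi e0.
pose q := Num.min rho (Num.min d (`|phi 0| / 2)).
have q0 : 0 < q by rewrite !lt_min rho0 d0.
have near x : eball y q x -> [/\ eball y rho x,
    `|edot u (x - y)| < `|phi 0| / 2 &
    `|phi 0 - phi ((x - y) *m E^T)| < `|phi 0| / 2].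
  rewrite /eball /= !lt_min => /and3P[xrho xd xe]; split=> //.
    apply: le_lt_trans (edot_CauchySchwarz _ _) _.
    by rewrite u1 mul1r.
  by apply: hd; apply: le_lt_trans (frame_proj_le EE Eu u1 _) xd.
have [h|h] := ltP (phi 0) 0.
  apply: ny; apply: filterS (nbhs_eball y q0) => x /near[xrho].
  rewrite (ltr0_norm h) => a b; apply/(graph x xrho).
  by move: a b; rewrite !ltr_norml => /andP[a1 a2] /andP[b1 b2]; lra.
have {}h : 0 < phi 0 by rewrite lt_def phi0.
have [x [Ox /near[xrho]]] := cy _ (nbhs_eball y q0).
rewrite (gtr0_norm h) => a b; move/(graph x xrho): Ox.
by move: a b; rewrite !ltr_norml => /andP[a1 a2] /andP[b1 b2]; lra.
Qed.

Lemma quadratic_form_perturb (R : realType) (n : nat) (H : 'M[R]_n) :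
  exists2 K, 0 < K & forall z1 z2 : 'rV[R]_n,
    edot (z1 *m H) z1 - K * (2 * enorm z1 * enorm z2 + enorm z2 ^+ 2) <=
    edot ((z1 + z2) *m H) (z1 + z2).
Proof.
have [K K0 HK] := enorm_mulmx H; exists K => // z1 z2.
have bound a b : - (K * enorm a * enorm b) <= edot (a *m H) b.
  rewrite lerNl; apply: le_trans (ler_norm _) _; rewrite normrN.
  apply: le_trans (edot_CauchySchwarz _ _) _.
  by rewrite ler_wpM2r ?enorm_ge0.
rewrite mulmxDl !edotDl !edotDr.
have := bound z1 z2; have := bound z2 z1; have := bound z2 z2; lra.
Qed.

(** [T] is spanned by [u] and the rows of [B *m E], that is, it is the image of an injective map;
    projecting along [u] leaves the row space of [B]. *)
Lemma graph_direction_space (R : realType) (n m : nat) (E : 'M[R]_(n, n.+1))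
    (u : 'rV[R]_n.+1) (B : 'M[R]_(m, n)) :
  E *m E^T = 1%:M -> E *m u^T = 0 -> enorm u = 1 ->
  (forall a : 'rV[R]_m, a *m B = 0 -> a = 0) ->
  exists2 T : {vspace 'rV[R]_n.+1}, \dim T = m.+1 &
    forall t, t \in T -> exists a : 'rV[R]_m, t *m E^T = a *m B.
Proof.
move=> EE Eu u1 injB; have uE := frame_axis Eu.
pose M : 'M[R]_(1 + m, n.+1) := col_mx u (B *m E).
pose T : {vspace 'rV[R]_n.+1} := (linfun (mulmxr M) @: fullv)%VS.
exists T.
  rewrite limg_dim_eq ?dimvf ?/dim /= ?mul1n //.
  apply/eqP; rewrite -subv0; apply/subvP => a.
  rewrite memv_cap memv_ker memv0 => /andP[_]; rewrite lfunE /= => /eqP.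
  rewrite -[a]hsubmxK mul_row_col mulmxA => aM.
  have a2 : rsubmx a = 0.
    apply: injB; have := congr1 (mulmx^~ E^T) aM.
    by rewrite mulmxDl -!mulmxA uE EE mulmx0 add0r mulmx1 mul0mx.
  have a1 : lsubmx a = 0.
    have := congr1 (mulmx^~ u^T) aM.
    by rewrite a2 !mul0mx addr0 -mulmxA (frame_axis_unit u1) mulmx1.
  by rewrite a1 a2 row_mx0.
move=> t /memv_imgP[a _ ->]; rewrite lfunE /=; exists (rsubmx a).
rewrite -{1}[a]hsubmxK mul_row_col mulmxDl -!mulmxA uE EE mulmx0 add0r.
by rewrite mulmx1.
Qed.

(* [nz], [n1], [n2] are the norms of [z = z1 + z2], [z1] and [z2], and [Q], [Q1]
   the values of the second derivative at [z] and [z1]. *)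
Lemma graph_gap (R : realFieldType) (c K r lam nz n1 n2 Q1 Q gap : R) :
  0 < c -> 0 < K -> 0 < lam -> lam <= r -> 0 <= n1 -> 0 <= n2 -> 0 <= nz ->
  nz <= r -> n2 <= lam -> nz <= n1 + n2 -> n1 <= nz + n2 ->
  c * n1 ^+ 2 <= Q1 -> Q1 - K * (2 * n1 * n2 + n2 ^+ 2) <= Q ->
  Q / 2 - c / 8 * nz ^+ 2 <= gap ->
  c / 8 * nz ^+ 2 - r * (c / 2 + 3 * K) * lam <= gap.
Proof.
move=> c0 K0 lam0 lamr n10 n20 nz0 nzr n2l tri tri1 pos pert low.
have h1 : n1 * n2 <= (2 * r) * lam by apply: ler_pM => //; lra.
have h2 : n2 * n2 <= r * lam by apply: ler_pM => //; lra.
have h3 : nz * nz <= (n1 + n2) * (n1 + n2) by apply: ler_pM.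
have h4 := sqr_ge0 (n1 - n2).
have rl : 0 <= r * lam by apply: mulr_ge0; lra.
have e1 : 2 * n1 * n2 + n2 ^+ 2 <= 6 * (r * lam) by rewrite expr2; lra.
have e2 : nz ^+ 2 <= 2 * n1 ^+ 2 + 2 * (r * lam) by rewrite !expr2 in h4 *; lra.
have := ler_wpM2l (ltW K0) e1; have := ler_wpM2l (ltW c0) e2; lra.
Qed.

(** The rows of [B] span the space [V] on which the Hessian is positive definite. *)
Lemma local_graph_Fk (R : realType) (n m : nat) (Omega : set 'rV[R]_n.+1)
    y E u phi (B : 'M[R]_(m, n)) (d0 : R) :
  local_graph Omega y E u phi -> boundary Omega y -> 0 < d0 ->
  (forall a : 'rV[R]_m, d0 * edot a a <= edot (a *m B *m hessian phi 0) (a *m B)) ->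
  exists2 r : R, 0 < r & forall delta : R, 0 < delta ->
  exists (T : {vspace 'rV[R]_n.+1}) (v : 'rV[R]_n.+1) (lambda theta : R),
    [/\ \dim T = m.+1, enorm v = 1, 0 < lambda, 0 < theta &
      forall x, Omega x -> eball y r x ->
        Defs.edist x [set y + t | t in [set t | t \in T]] < lambda ->
        edot v (x - y) < theta -> eball y delta x].
Proof.
move=> lg yO d00 posB; have phi0 := local_graph_origin lg yO.
have [EE Eu u1 C2phi [rho rho0 graph]] := lg.
set p := gradient phi 0; set H := hessian phi 0 in posB *.
have injB (a : 'rV[R]_m) : a *m B = 0 -> a = 0.
  move=> aB; apply: edot_eq0; apply/eqP; rewrite eq_le edot_ge0 andbT.
  rewrite -(pmulr_rle0 _ d00); apply: le_trans (posB a) _.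
  by rewrite aB mul0mx /edot mul0mx mxE.
have [T dT TB] := graph_direction_space EE Eu u1 injB.
have [L L0 BL] := enorm_mulmx B.
have [K K0 HK] := quadratic_form_perturb H.
(* As [|a B| <= L |a|], positivity in terms of [a] becomes positivity in terms of the vector [a B]
   of [V]. *)
pose c := d0 / L ^+ 2.
have c0 : 0 < c by rewrite divr_gt0 // exprn_gt0.
have posc (a : 'rV[R]_m) : c * enorm (a *m B) ^+ 2 <= edot (a *m B *m H) (a *m B).
  apply: le_trans (posB a); rewrite -enorm_sqr /c mulrAC ler_pdivrMr ?exprn_gt0 //.
  rewrite -mulrA ler_pM2l // -exprMn ler_pXn2r ?nnegrE ?mulr_ge0 ?enorm_ge0  ?(ltW L0) //.
  by rewrite mulrC BL.
have [r1 r10 taylor] := taylor2_peano_lower C2phi (divr_gt0 c0 (ltr0n R 8)).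
pose r := Num.min rho r1; have r0 : 0 < r by rewrite lt_min rho0.
exists r => // delta delta0.
pose C := r * (c / 2 + 3 * K).
have C0 : 0 < C by rewrite mulr_gt0 //; lra.
have P0 := enorm_ge0 p.
(* The target is [|z| < d2] and [|w| <= eta + |p| d2] with [eta <= d2], which add up to less than
   [delta]. *)
pose d2 := delta / (2 + enorm p).
have d20 : 0 < d2 by rewrite divr_gt0 // ltr_wpDr.
pose eta := Num.min d2 (c * d2 ^+ 2 / 16).
have eta0 : 0 < eta by rewrite lt_min d20 divr_gt0 // mulr_gt0 // exprn_gt0.
pose s := Num.sqrt (1 + edot p p).
have s0 : 0 < s by rewrite sqrtr_gt0 ltr_wpDr // edot_ge0.
pose lam := Num.min r (eta / C).
have lam0 : 0 < lam by rewrite lt_min r0 divr_gt0.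
have lamr : lam <= r by rewrite ge_min lexx.
have lamC : C * lam <= eta by rewrite mulrC -ler_pdivlMr // ge_min lexx orbT.
(* [v] is the unit inner normal; with threshold [eta / s] the condition on [x] reads
   [w - <p,z> < eta]. *)
exists T, (s^-1 *: (u - p *m E)), lam, (eta / s).
split=> //.
- rewrite enormZ ger0_norm ?invr_ge0 ?ltW //.
  have -> : enorm (u - p *m E) = s.
    rewrite /enorm /s; congr Num.sqrt.
    rewrite edotDl !edotDr !edotNl !edotNr (edotC u) !edot_mulmx.
    rewrite (frame_axis Eu) -mulmxA EE mulmx1 -(enorm_sqr u) u1 expr1n.
    by rewrite {1 2}/edot trmx0 mulmx0 mxE; lra.
  by rewrite mulVf ?gt_eqF.
- by rewrite divr_gt0.
move=> x Ox xr xT.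
rewrite edotZl edotDl edotNl edot_mulmx mulrC ltr_pM2r ?invr_gt0 // => xv.
have [_ [t tT <-] xt] := ltr_edist (ex_intro _ _ (ex_intro2 _ _ 0 (mem0v T) erefl)) xT.
have [a ta] := TB t tT.
(* [z1] is the part of [z] in [V], and [z2] the error from [x] being only within [lam] of
   [y + T]. *)
set z := (x - y) *m E^T in xv *; set w := edot u (x - y) in xv *.
have zr : enorm z < r by apply: le_lt_trans (frame_proj_le EE Eu u1 _) xr.
pose z1 := a *m B; pose z2 := (x - (y + t)) *m E^T.
have zE : z = z1 + z2.
  by rewrite /z1 /z2 -ta -mulmxDl [t + _]addrC opprD addrA subrK.
have z2lam : enorm z2 <= lam.
  by apply: le_trans (frame_proj_le EE Eu u1 _) (ltW xt).
have phiw : phi z < w.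
  by apply/(graph x) => //; apply: lt_le_trans xr _; rewrite ge_min lexx.
have rr1 : r <= r1 by rewrite ge_min lexx orbT.
have lower := taylor z (lt_le_trans zr rr1).
rewrite phi0 add0r -/p -/H in lower.
have pert := HK z1 z2; rewrite -zE in pert.
have pos1 := posc a; rewrite -/z1 in pos1.
have n1 := enorm_ge0 z1; have n2 := enorm_ge0 z2; have nz := enorm_ge0 z.
have tri : enorm z <= enorm z1 + enorm z2 by rewrite zE ler_enormD.
have tri1 : enorm z1 <= enorm z + enorm z2.
  have -> : z1 = z - z2 by rewrite zE addrK.
  by rewrite -(enormN z2) ler_enormD.
have key : c / 8 * enorm z ^+ 2 - C * lam <= w - edot p z.
  apply: (graph_gap c0 K0 lam0 lamr n1 n2 nz (ltW zr) z2lam tri tri1 pos1 pert).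
  by move: lower phiw; move: (edot p z) (phi z) => ? ? ? ?; lra.
clear pert lower pos1 tri tri1 taylor HK BL posc posB injB TB graph.
(* [key] with [C * lam <= eta] and the threshold gives [c / 8 * |z|^2 < 2 * eta]. *)
have big : c * enorm z ^+ 2 < 16 * eta by lra.
have zd2 : enorm z < d2.
  rewrite -(@ltr_pXn2r _ 2) ?nnegrE ?(ltW d20) // -(ltr_pM2l c0).
  apply: lt_le_trans big _; rewrite mulrC -ler_pdivlMr //.
  by rewrite /eta ge_min lexx orbT.
have etad2 : eta <= d2 by rewrite ge_min lexx.
have cz : 0 <= c / 8 * enorm z ^+ 2 by rewrite mulr_ge0 ?sqr_ge0 // divr_ge0 ?ltW.
have w1 : `|w - edot p z| <= eta by rewrite ler_norml; apply/andP; split; lra.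
have w2 : `|w| <= eta + enorm p * d2.
  rewrite -[w](subrK (edot p z)); apply: le_trans (ler_normD _ _) _.
  apply: lerD => //; apply: le_trans (edot_CauchySchwarz _ _) _.
  by rewrite ler_wpM2l // (ltW zd2).
rewrite /eball /=; apply: le_lt_trans (frame_enorm_le EE Eu u1 _) _.
rewrite -/w -/z.
have -> : delta = (2 + enorm p) * d2 by rewrite mulrC divfK // gt_eqF // ltr_wpDr.
lra.
Qed.

Lemma rowsub_conj (R : pzSemiRingType) (m n : nat) (f : 'I_m -> 'I_n)
    (P : 'M[R]_n) (H : 'M[R]_n) :
  rowsub f P *m H *m (rowsub f P)^T = mxsub f f (P *m H *m P^T).
Proof.
apply/matrixP => i l; rewrite !mxE; apply: eq_bigr => k _; rewrite !mxE.
by congr (_ * _); apply: eq_bigr => h _; rewrite !mxE.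
Qed.

Lemma condH_condFk (R : realType) (n j k : nat) (Omega : set 'rV[R]_n.+1) :
  (0 < k <= n.+1)%N -> (n.+1 - k + 1 = j \/ n.+1 - k + 1 = n.+1 - j + 1)%N ->
  C2_boundary Omega -> condH Omega j -> condFk Omega k.
Proof.
move=> /andP[k0 kn] jk bdC2 hH y yO.
have [E [u [phi lg]]] := bdC2 y yO.
have [_ _ _ C2phi _] := lg.
have [kappa [P [sk charP uP PHP]]] := principal_basis (gradient phi 0) (hessian_sym C2phi).
have pk : principal_curvatures Omega y kappa by split=> //; exists E, u, phi.
set s := Num.sqrt _ in PHP.
have s0 : 0 < s by rewrite sqrtr_gt0 ltr_wpDr // edot_ge0.
case: k k0 kn jk => // m _ mn jk.
have fP (i : 'I_m) : (n - m + i < n)%N by have := ltn_ord i; lia.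
(* With [k = m + 1], [f] runs through the [m] largest curvatures; counted from 1, the first has
   index [N - k + 1], where (H) applies. *)
pose f i := Ordinal (fP i).
have [k0 k00 hk] : exists2 k0, 0 < k0 & forall i, k0 <= tnth kappa (f i).
  (* For [m = 0] there is no curvature to bound and any positive [k0] works; this is the void
     requirement of index [N]. *)
  case: m mn jk fP @f => [|m] mn jk fP f; first by exists 1 => // -[].
  exists (tnth kappa (f ord0)).
    by apply: (hH y kappa yO pk); move: jk => /=; lia.
  move=> i; rewrite !(tnth_nth 0); apply: (sorted_leq_nth le_trans le_refl) => //.
  - by rewrite inE size_tuple fP.
  - by rewrite inE size_tuple fP.
  - by rewrite /= addn0 leq_addr.
pose B : 'M[R]_(m, n) := rowsub f P.
have BHB : B *m hessian phi 0 *m B^T = diag_mx (\row_i (s * tnth kappa (f i))).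
  rewrite rowsub_conj PHP; apply/matrixP => i l; rewrite !mxE.
  by rewrite -!val_eqE /= eqn_add2l.
have posB (a : 'rV[R]_m) : s * k0 * edot a a <= edot (a *m B *m hessian phi 0) (a *m B).
  have -> : edot (a *m B *m hessian phi 0) (a *m B) =
            edot (a *m (B *m hessian phi 0 *m B^T)) a.
    by rewrite /edot trmx_mul !mulmxA.
  rewrite BHB mul_mx_diag !edotE mulr_sumr; apply: ler_sum => i _; rewrite !mxE.
  rewrite [leRHS]mulrAC [leRHS]mulrC; apply: ler_wpM2r; first by rewrite -expr2 sqr_ge0.
  by rewrite ler_pM2l.
have [r r0 F] := local_graph_Fk lg yO (mulr_gt0 s0 k00) posB.
exists r; first exact: r0.
move=> delta delta0; have [T [v [lam [th [dT v1 lam0 th0 incl]]]]] := F delta delta0.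
exists T, v, lam, th; split; [exact: dT|exact: v1|exact: lam0|exact: th0|].
by move=> Tlambda x [[[Ox xr] xT] xv]; exact: incl.
Qed.

Theorem mainTheorem6 (R : realType) (n j : nat) (Omega : set 'rV[R]_n.+1)
    (Omega_domain : is_domain Omega) (Omega_bounded : bounded_set Omega)
    (hj : (1 <= j <= n.+1)%N) :
  (C2_boundary Omega -> condH Omega j -> condF Omega j) /\
  (condF Omega j -> condG Omega j).
Proof.
have [_ oO _] := Omega_domain.
(* [j |-> N - j + 1] is an involution, so (H) covers the index needed for each of the two
   conditions. *)
have j' : (n.+1 - (n.+1 - j + 1) + 1 = j)%N by lia.
split=> [bdC2 hH|[Fj Fj']].
  split; apply: condH_condFk bdC2 hH; try lia.
(* The indices are exchanged: each part of (G) comes from the other part of (F), the two indices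
   adding up to [N + 1]. *)
split; [move: Fj'|move: Fj]; apply: condFk_condGk => //; lia.
Qed.
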